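(* Let $n\ge 4$, let $\mathbb{K}$ be a field, and let $G$ be a finite simple graph on $[n]$ with no isolated vertices. Then the following are equivalent: (1) $I_c(G)$ has linear quotients. (2) $I_c(G)$ has linear resolution. (3) $I_c(G)$ is linearly related. (4) $G$ is connected.
   Context: $S=\mathbb{K}[x_1,\dots,x_n]$ is the standard graded polynomial ring and $[n]=\{1,\dots,n\}$. For a simple graph $G$ with vertex set $[n]$ and edge set $E(G)$, the complementary edge ideal is $I_c(G)=(x_1\cdots x_n/(x_ix_j) : \{i,j\}\in E(G))\subset S$. A monomial ideal $I$ has linear quotients if its minimal monomial generators can be ordered $u_1,\dots,u_r$ so that the colon ideal $(u_1,\dots,u_{i-1}):u_i$ is generated by variables for each $i=2,\dots,r$. A graded ideal $I$ generated in a single degree $d$ has linear resolution if its graded Betti numbers satisfy $\beta_{i,j}(I)=0$ whenever $j\neq i+d$; it is linearly related if its first syzygy module is generated by linear relations, i.e. $\beta_{1,j}(I)=0$ for $j\ne d+1$. *)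

(* Defs.v *)
From HB Require Import structures.
From mathcomp Require Import all_boot all_order all_algebra.
From mathcomp Require Import mpoly.
Set Implicit Arguments.
Unset Strict Implicit.
Unset Printing Implicit Defensive.
Import GRing.Theory.
Local Open Scope ring_scope.

(* Ideals of {mpoly K[n]} are Prop-valued predicates; two ideals are identified
   when they have the same elements. *)

Definition ideal_gen (n : nat) (K : fieldType) (A : {mpoly K[n]} -> Prop)
    (p : {mpoly K[n]}) : Prop :=
  exists s : seq ({mpoly K[n]} * {mpoly K[n]}),
    (forall c, c \in s -> A c.2) /\ p = \sum_(c <- s) c.1 * c.2.

Definition monomial_ideal_gen (n : nat) (K : fieldType) (s : seq 'X_{1..n}) :
    {mpoly K[n]} -> Prop :=
  ideal_gen (fun p => exists2 m, m \in s & p = 'X_[m]).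

Definition variable_ideal (n : nat) (K : fieldType) (V : {set 'I_n}) :
    {mpoly K[n]} -> Prop :=
  ideal_gen (fun p => exists2 k, k \in V & p = 'X_k).

Definition colon (n : nat) (K : fieldType) (J : {mpoly K[n]} -> Prop)
    (f : {mpoly K[n]}) (p : {mpoly K[n]}) : Prop := J (p * f).

(* The graph on the vertex set 'I_n is given by its adjacency relation. *)
Definition compl_edge_ideal (n : nat) (K : fieldType) (G : rel 'I_n) :
    {mpoly K[n]} -> Prop :=
  ideal_gen (fun p => exists i j : 'I_n,
    G i j /\ p = \prod_(k < n | (k != i) && (k != j)) 'X_k).
Arguments compl_edge_ideal [n] K G p.

(* The second clause forces s to be duplicate-free. *)
Definition minimal_monomial_generators (n : nat) (K : fieldType)
    (I : {mpoly K[n]} -> Prop) (s : seq 'X_{1..n}) : Prop :=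
  (forall p, I p <-> monomial_ideal_gen s p) /\
  (forall m, m \in s -> ~ monomial_ideal_gen (rem m s) ('X_[m] : {mpoly K[n]})).

Definition has_linear_quotients (n : nat) (K : fieldType)
    (I : {mpoly K[n]} -> Prop) : Prop :=
  exists s : seq 'X_{1..n},
    minimal_monomial_generators I s /\
    (forall i, (0 < i < size s)%N ->
       exists V : {set 'I_n}, forall p : {mpoly K[n]},
         colon (monomial_ideal_gen (take i s)) 'X_[nth 0%MM s i] p
         <-> variable_ideal V p).

(* Data of an augmented sequence ... -> F_1 -> F_0 -> S of finitely generated
   graded free modules, F_i being the direct sum of the S(- gshift i k) for
   k < grank i. Elements of F_i are row vectors, on which the maps act by
   right multiplication. *)
Record graded_free_seq (n : nat) (K : fieldType) := GradedFreeSeq {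
  grank  : nat -> nat;
  gshift : forall i, 'I_(grank i) -> nat;
  gdiff  : forall i, 'M[{mpoly K[n]}]_(grank i.+1, grank i);
  gaug   : 'cV[{mpoly K[n]}]_(grank 0)
}.

(* Degree-preserving maps: a nonzero entry from S(-a) to S(-b) is homogeneous
   of degree a - b; the sum form makes it vanish when a < b. *)
Definition graded_maps (n : nat) (K : fieldType)
    (F : graded_free_seq n K) : Prop :=
  (forall k, gaug F k ord0 \is (gshift (i := 0) k).-homog) /\
  (forall i k l m, m \in msupp (gdiff F i k l) ->
     (mdeg m + gshift l)%N = gshift k).

Definition resolves (n : nat) (K : fieldType)
    (I : {mpoly K[n]} -> Prop) (F : graded_free_seq n K) : Prop :=
  [/\ forall p, I p <-> (exists v : 'rV_(grank F 0), p = (v *m gaug F) ord0 ord0),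
      forall v : 'rV_(grank F 0),
        v *m gaug F = 0 <-> (exists w, v = w *m gdiff F 0)
    & forall i (v : 'rV_(grank F i.+1)),
        v *m gdiff F i = 0 <-> (exists w, v = w *m gdiff F i.+1)].

(* F_(i+1) maps into (x_1, ..., x_n) F_i: the entries have no constant term. *)
Definition minimal_maps (n : nat) (K : fieldType)
    (F : graded_free_seq n K) : Prop :=
  forall i k l, (gdiff F i k l)@_0%MM = 0.

Definition minimal_graded_free_resolution (n : nat) (K : fieldType)
    (I : {mpoly K[n]} -> Prop) (F : graded_free_seq n K) : Prop :=
  [/\ graded_maps F, resolves I F & minimal_maps F].

(* "beta_(i,j)(I) = b". A minimal graded free resolution of a graded ideal
   exists and is unique up to isomorphism, so exactly one b satisfies this. *)
Definition graded_betti (n : nat) (K : fieldType)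
    (I : {mpoly K[n]} -> Prop) (i j b : nat) : Prop :=
  exists2 F : graded_free_seq n K,
    minimal_graded_free_resolution I F &
    #|[set k : 'I_(grank F i) | gshift k == j]| = b.

Definition generated_in_degree (n : nat) (K : fieldType)
    (I : {mpoly K[n]} -> Prop) (d : nat) : Prop :=
  exists s : seq {mpoly K[n]},
    (forall p, p \in s -> p \is d.-homog) /\
    (forall p, I p <-> ideal_gen (fun q => q \in s) p).

Definition has_linear_resolution (n : nat) (K : fieldType)
    (I : {mpoly K[n]} -> Prop) : Prop :=
  exists d, generated_in_degree I d /\
    forall i j, j != (i + d)%N -> graded_betti I i j 0.

Definition linearly_related (n : nat) (K : fieldType)
    (I : {mpoly K[n]} -> Prop) : Prop :=
  exists d, generated_in_degree I d /\
    forall j, j != d.+1 -> graded_betti I 1 j 0.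

(* Main.v *)
Require Import Defs.
From HB Require Import structures.
From mathcomp Require Import all_boot all_order all_algebra.
From mathcomp Require Import mpoly.
From Stdlib Require Import ClassicalEpsilon.
Set Implicit Arguments.
Unset Strict Implicit.
Unset Printing Implicit Defensive.
Import GRing.Theory.
Local Open Scope ring_scope.

(** The four conditions are proved equivalent in a cycle.

    Linear quotients imply a linear resolution because of mapping cones.
    If J has a d-linear resolution, u is homogeneous of degree d and the ideal
    L = (J : u) has a 1-linear resolution, then multiplication by u lifts to a
    chain map from the resolution of L to that of J; all its entries can be
    taken to be linear forms for degree reasons, so the mapping cone is a
    d-linear, hence minimal, resolution of J + (u) ([mapping_cone]). This is
    used twice. With L = J it resolves the ideals generated by variables, one
    variable at a time, since (x_1, .., x_k) : x_(k+1) = (x_1, .., x_k); this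
    replaces the Koszul complex. With L such a variable ideal it then resolves
    an ideal with linear quotients, one generator at a time.

    A linear resolution is trivially linearly related.

    For a disconnected G, let x and y lie in different components, C that of x,
    and let e, f be edges at x and at y, with generators u_e and u_f. The
    syzygy x_e u_e = x_f u_f, both sides being x_1 ... x_n, is quadratic, and it
    is not generated by linear ones. To see this, keep in a polynomial only the
    monomials in which some variable of C does not occur. On the span of the
    generators this selects the edges inside C, and it commutes with
    multiplication by polynomials of degree at most 1: an edge has two vertices
    in C and a single variable can only cover one of them
    ([restrict_mul_linear]). So every linear syzygy remains a syzygy after
    truncating the generators, while the quadratic syzygy above becomes
    x_1 ... x_n <> 0. Hence a minimal resolution has an element of degree n in
    the basis of F_1, whereas linear relations have degree n - 1.

    For a connected G the edges can be listed so that each one but the first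
    meets an earlier one ([connected_edge_order]). If an earlier f meets e in
    all but one vertex k of e, then u_f : u_e is x_k; an earlier f disjoint from
    e only contributes the product of the two variables of e, which is a
    multiple of such an x_k. So all colon ideals are generated by variables. *)

(** * Monomial ideals *)

Lemma ideal_gen_incl n (K : fieldType) (A : {mpoly K[n]} -> Prop) p :
  A p -> ideal_gen A p.
Proof.
move=> Ap; exists [:: (1, p)]; split; last by rewrite big_seq1 mul1r.
by move=> c; rewrite inE => /eqP ->.
Qed.

Lemma ideal_gen0 n (K : fieldType) (A : {mpoly K[n]} -> Prop) : ideal_gen A 0.
Proof. by exists [::]; split=> //; rewrite big_nil. Qed.

Lemma ideal_genD n (K : fieldType) (A : {mpoly K[n]} -> Prop) p q :
  ideal_gen A p -> ideal_gen A q -> ideal_gen A (p + q).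
Proof.
move=> [s [sA ->]] [t [tA ->]]; exists (s ++ t); split; last by rewrite big_cat.
by move=> c; rewrite mem_cat => /orP[/sA|/tA].
Qed.

Lemma ideal_genM n (K : fieldType) (A : {mpoly K[n]} -> Prop) q p :
  ideal_gen A p -> ideal_gen A (q * p).
Proof.
move=> [s [sA ->]]; exists [seq (q * c.1, c.2) | c <- s]; split.
  by move=> c /mapP[c' /sA ? ->].
by rewrite big_map mulr_sumr; apply: eq_bigr => c _; rewrite mulrA.
Qed.

Lemma ideal_gen_sum n (K : fieldType) (A : {mpoly K[n]} -> Prop)
    (T : eqType) (r : seq T) (F : T -> {mpoly K[n]}) :
  (forall i, i \in r -> ideal_gen A (F i)) -> ideal_gen A (\sum_(i <- r) F i).
Proof.
elim: r => [|i r IHr] AF; first by rewrite big_nil; apply: ideal_gen0.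
rewrite big_cons; apply: ideal_genD; first by apply: AF; rewrite mem_head.
by apply: IHr => j rj; apply: AF; rewrite inE rj orbT.
Qed.

Lemma ideal_gen_ind n (K : fieldType) (A Q : {mpoly K[n]} -> Prop) :
  Q 0 -> (forall p q, Q p -> Q q -> Q (p + q)) -> (forall a p, A p -> Q (a * p)) ->
  forall p, ideal_gen A p -> Q p.
Proof.
move=> Q0 QD QM p [s [sA ->]]; elim: s sA => [|c s IHs] sA.
  by rewrite big_nil.
rewrite big_cons; apply: QD; first by apply/QM/sA/mem_head.
by apply: IHs => c' sc'; apply: sA; rewrite inE sc' orbT.
Qed.

Lemma ideal_gen_sub n (K : fieldType) (A B : {mpoly K[n]} -> Prop) :
  (forall p, A p -> ideal_gen B p) -> forall p, ideal_gen A p -> ideal_gen B p.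
Proof.
move=> AB; apply: ideal_gen_ind => [|p q|q p /AB].
- exact: ideal_gen0.
- exact: ideal_genD.
exact: ideal_genM.
Qed.

Lemma eq_ideal_gen n (K : fieldType) (A B : {mpoly K[n]} -> Prop) :
  (forall p, A p <-> B p) -> forall p, ideal_gen A p <-> ideal_gen B p.
Proof.
by move=> AB p; split; apply: ideal_gen_sub => q /AB; apply: ideal_gen_incl.
Qed.

Lemma supp_eq0 n (K : fieldType) (p : {mpoly K[n]}) :
  (forall m, m \notin msupp p) -> p = 0.
Proof.
move=> p0; apply: msuppnil0; case: (msupp p) p0 => // m s /(_ m).
by rewrite mem_head.
Qed.

Lemma msuppMP n (K : fieldType) (p q : {mpoly K[n]}) m :
  m \in msupp (p * q) -> exists m1 m2,
    [/\ m1 \in msupp p, m2 \in msupp q & m = (m1 + m2)%MM].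
Proof.
by move/msuppM_le/allpairsP => [[m1 m2] /= [pm1 qm2 ->]]; exists m1, m2.
Qed.

Lemma lem_exists_add n (m1 m2 : 'X_{1..n}) :
  (m1 <= m2)%MM -> exists m, m2 = (m + m1)%MM.
Proof. by move=> le12; exists (m2 - m1)%MM; rewrite submK. Qed.

Lemma lem_antisym n (m1 m2 : 'X_{1..n}) :
  (m1 <= m2)%MM -> (m2 <= m1)%MM -> m1 = m2.
Proof.
move=> /mnm_lepP le12 /mnm_lepP le21; apply/mnmP => i.
by apply/eqP; rewrite eqn_leq le12 le21.
Qed.

Lemma lem_mdeg_eq n (m1 m2 : 'X_{1..n}) :
  (m1 <= m2)%MM -> mdeg m1 = mdeg m2 -> m1 = m2.
Proof.
move=> /lem_exists_add[m ->]; rewrite mdegD -[LHS]add0n => /addIn/esym/eqP.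
by rewrite mdeg_eq0 => /eqP ->; rewrite add0m.
Qed.

(** Sufficiency splits p into its terms, each of which is a multiple of a
    generator; necessity holds because no cancellation creates new monomials.
    [M] is a predicate so as to cover monomials, variables and edges alike. *)
Lemma monomial_memP n (K : fieldType) (M : 'X_{1..n} -> Prop)
    (p : {mpoly K[n]}) :
  ideal_gen (fun q => exists2 m, M m & q = 'X_[m]) p <->
  forall m, m \in msupp p -> exists2 m', M m' & (m' <= m)%MM.
Proof.
split=> [[s [sM ->]] m|Mp].
  move=> /msupp_sum_le/flattenP[t /mapP[c]].
  rewrite mem_filter /= => /sM[m' Mm' ->] ->.
  rewrite (perm_mem (msuppMX _ _)) => /mapP[m1 _ ->].
  by exists m' => //; apply: lem_addr.
rewrite (mpolyE p); apply: ideal_gen_sum => m /Mp[m' Mm' /lem_exists_add[m1 ->]].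
rewrite mpolyXD -mul_mpolyC; apply/ideal_genM/ideal_genM.
by apply: ideal_gen_incl; exists m'.
Qed.

Lemma monomial_ideal_genP n (K : fieldType) (s : seq 'X_{1..n})
    (p : {mpoly K[n]}) :
  monomial_ideal_gen s p <->
  forall m, m \in msupp p -> exists2 m', m' \in s & (m' <= m)%MM.
Proof. exact: (monomial_memP (fun m => m \in s)). Qed.

Lemma variable_idealP n (K : fieldType) (V : {set 'I_n}) (p : {mpoly K[n]}) :
  variable_ideal V p <->
  forall m, m \in msupp p -> exists2 k, k \in V & (0 < m k)%N.
Proof.
have U_le k (m : 'X_{1..n}) : (U_(k) <= m)%MM = (0 < m k)%N.
  apply/mnm_lepP/idP => [/(_ k)|mk i]; rewrite mnm1E ?eqxx //.
  by case: eqP => // <-.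
have [VM MV] := monomial_memP
  (fun m : 'X_{1..n} => exists2 k, k \in V & m = U_(k)%MM) p.
have gensE q : (exists2 k, k \in V & q = 'X_k :> {mpoly K[n]}) <->
    exists2 m : 'X_{1..n}, (exists2 k, k \in V & m = U_(k)%MM) & q = 'X_[m].
  split; first by case=> k Vk ->; exists U_(k)%MM => //; exists k.
  by case=> m [k Vk ->] ->; exists k.
split=> [/(eq_ideal_gen gensE)/VM Vp m /Vp[_ [k Vk ->]]|Vp].
  by rewrite U_le; exists k.
apply/(eq_ideal_gen gensE)/MV => m /Vp[k Vk mk].
by exists U_(k)%MM; [exists k | rewrite U_le].
Qed.

Lemma monomial_ideal_genX n (K : fieldType) (s : seq 'X_{1..n}) m :
  monomial_ideal_gen s ('X_[m] : {mpoly K[n]}) <->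
  exists2 m', m' \in s & (m' <= m)%MM.
Proof.
rewrite monomial_ideal_genP; split=> [|sm m'].
  by apply; rewrite msuppX mem_head.
by rewrite msuppX inE => /eqP ->.
Qed.

Lemma monomial_idealMX n (K : fieldType) (s : seq 'X_{1..n}) m
    (p : {mpoly K[n]}) :
  monomial_ideal_gen s (p * 'X_[m]) <->
  forall m1, m1 \in msupp p -> exists2 m', m' \in s & (m' <= m1 + m)%MM.
Proof.
rewrite monomial_ideal_genP; split=> sp m1 pm1.
  by apply: sp; rewrite (perm_mem (msuppMX _ _)) addmC map_f.
by move: pm1; rewrite (perm_mem (msuppMX _ _)) => /mapP[m2 /sp ? ->]; rewrite addmC.
Qed.

(** * Complementary edge monomials *)

Definition edges n (G : rel 'I_n) : {set {set 'I_n}} :=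
  [set [set p.1; p.2] | p : 'I_n * 'I_n & G p.1 p.2].

Definition compl_monomial n (e : {set 'I_n}) : 'X_{1..n} :=
  [multinom (k \notin e : nat) | k < n].

Lemma edgesP n (G : rel 'I_n) e :
  reflect (exists i j, G i j /\ e = [set i; j]) (e \in edges G).
Proof.
apply: (iffP imsetP) => [[[i j]]|[i [j [Gij ->]]]].
  by rewrite inE => Gij ->; exists i, j.
by exists (i, j); rewrite ?inE.
Qed.

Lemma compl_monomialE n (e : {set 'I_n}) k : compl_monomial e k = (k \notin e).
Proof. by rewrite mnmE. Qed.

Lemma compl_monomial_inj n : injective (@compl_monomial n).
Proof.
move=> e f /mnmP eqef; apply/setP => k.
by move: (eqef k); rewrite !compl_monomialE; case: (k \in e) (k \in f) => [] [].
Qed.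

Lemma compl_monomial_eq0 n (e : {set 'I_n}) k : (compl_monomial e k == 0%N) = (k \in e).
Proof. by rewrite compl_monomialE; case: (k \in e). Qed.

Lemma mdeg_compl_monomial n (e : {set 'I_n}) : mdeg (compl_monomial e) = (n - #|e|)%N.
Proof.
rewrite mdegE (eq_bigr (fun k => (k \in ~: e : nat))); last first.
  by move=> k _; rewrite compl_monomialE inE.
by rewrite -big_mkcond sum1_card cardsCs setCK card_ord.
Qed.

Lemma cards_edge n (G : rel 'I_n) e :
  irreflexive G -> e \in edges G -> #|e| = 2%N.
Proof.
move=> Girr /edgesP[i [j [Gij ->]]]; rewrite cards2.
by have -> : i != j by apply: contraTneq Gij => ->; rewrite Girr.
Qed.

Lemma mdeg_compl_monomial_edge n (G : rel 'I_n) e :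
  irreflexive G -> e \in edges G -> mdeg (compl_monomial e) = n.-2.
Proof. by move=> Girr eG; rewrite mdeg_compl_monomial (cards_edge Girr eG) subn2. Qed.

Lemma prod_edge_monomial n (K : fieldType) (i j : 'I_n) :
  \prod_(k < n | (k != i) && (k != j)) 'X_k =
    'X_[compl_monomial [set i; j]] :> {mpoly K[n]}.
Proof.
rewrite [RHS]mpolyXE_id big_mkcond; apply: eq_bigr => k _.
by rewrite compl_monomialE !inE negb_or; case: ifP => _; rewrite ?expr1 ?expr0.
Qed.

Lemma compl_edge_idealP n (K : fieldType) (G : rel 'I_n) (p : {mpoly K[n]}) :
  compl_edge_ideal K G p <->
  forall m, m \in msupp p -> exists2 e, e \in edges G & (compl_monomial e <= m)%MM.
Proof.
have gensE q : (exists i j : 'I_n, G i j /\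
      q = \prod_(k < n | (k != i) && (k != j)) 'X_k :> {mpoly K[n]}) <->
    exists2 m, m \in [seq compl_monomial e | e in edges G] & q = 'X_[m].
  split=> [[i [j [Gij ->]]]|[_ /imageP[_ /edgesP[i [j [Gij ->]]] ->] ->]].
    exists (compl_monomial [set i; j]); last exact: prod_edge_monomial.
    by apply: image_f; apply/edgesP; exists i, j.
  by exists i, j; rewrite prod_edge_monomial.
apply: iff_trans (eq_ideal_gen gensE p) _.
apply: iff_trans (monomial_ideal_genP _ p) _.
split=> Ip m /Ip; first by case=> _ /imageP[e eG ->] ?; exists e.
by case=> e eG le; exists (compl_monomial e) => //; apply: image_f.
Qed.

Lemma compl_edge_ideal_edge n (K : fieldType) (G : rel 'I_n) e :
  e \in edges G -> compl_edge_ideal K G 'X_[compl_monomial e].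
Proof.
move=> eG; apply/compl_edge_idealP => m; rewrite msuppX inE => /eqP ->.
by exists e => //; apply: lepm_refl.
Qed.

(** * Homogeneous components of linear combinations *)

(** Multiplication by a homogeneous polynomial of degree [g] shifts the
    grading, so it carries homogeneous components to homogeneous components. *)
Lemma pihomogMr n (K : fieldType) N g (a q : {mpoly K[n]}) :
  q \is g.-homog ->
  pihomog mdeg N (a * q) =
    if (g <= N)%N then pihomog mdeg (N - g) a * q else 0.
Proof.
move=> qg; rewrite [a in LHS]mpolyE [a in RHS]mpolyE mulr_suml !raddf_sum /=.
have Xq m : pihomog mdeg N (a@_m *: 'X_[m] * q) =
    if (g <= N)%N then pihomog mdeg (N - g) (a@_m *: 'X_[m]) * q else 0.
  have Xqh : a@_m *: 'X_[m] * q \is (mdeg m + g).-homog.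
    by apply: dhomogM => //; apply: dhomogZ; rewrite dhomogX.
  rewrite [in RHS]linearZ /= pihomogX.
  have [le_gN|lt_Ng] := leqP.
    have [eqm|nem] := eqVneq (mdeg m) (N - g)%N.
      by rewrite pihomog_dE // -(subnK le_gN) -eqm.
    rewrite scaler0 mul0r (pihomog_ne0 _ Xqh) //.
    by apply: contraNneq nem => <-; rewrite addnK.
  rewrite (pihomog_ne0 _ Xqh) //; apply: contraTneq lt_Ng => <-.
  by rewrite -leqNgt leq_addl.
rewrite (eq_bigr _ (fun m _ => Xq m)).
by case: leqP => _; rewrite ?mulr_suml // big1.
Qed.

(** A homogeneous combination of homogeneous rows has homogeneous
    coefficients without loss of generality: replace each coefficient by its
    component of the only degree that contributes. *)
Lemma homog_combination n (K : fieldType) r c (g : 'I_r -> nat) N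
    (w : 'rV[{mpoly K[n]}]_r) (A : 'M[{mpoly K[n]}]_(r, c)) :
  (forall k l, A k l \is (g k).-homog) ->
  (forall l, (w *m A) ord0 l \is N.-homog) ->
  exists w' : 'rV_r,
    [/\ forall k, w' ord0 k \is (N - g k).-homog,
        forall k, (N < g k)%N -> w' ord0 k = 0 & w' *m A = w *m A].
Proof.
move=> Ag wAN.
exists (\row_k if (g k <= N)%N then pihomog mdeg (N - g k) (w ord0 k) else 0).
split=> [k|k lt_Ng|].
- by rewrite mxE; case: ifP => _; [apply: pihomogP | apply: dhomog0].
- by rewrite mxE leqNgt lt_Ng.
apply/rowP => l; rewrite -(pihomog_dE (wAN l)) !mxE raddf_sum /=.
apply: eq_bigr => k _; rewrite !mxE (pihomogMr _ _ (Ag k l)).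
by case: ifP => // _; rewrite mul0r.
Qed.

(** Chain maps are built with this lemma: if the rows of [M] lie in the image
    of [D], the factorization can be chosen with entries of the expected
    degree. *)
Lemma homog_lift n (K : fieldType) r s t b e (D : 'M[{mpoly K[n]}]_(s, r))
    (M : 'M[{mpoly K[n]}]_(t, r)) :
  (forall k l, D k l \is e.-homog) -> (forall k l, M k l \is (b + e).-homog) ->
  (forall i, exists w, row i M = w *m D) ->
  exists W : 'M_(t, s), (forall k l, W k l \is b.-homog) /\ W *m D = M.
Proof.
move=> De MN rowM.
have /fin_all_exists[W Wok] (i : 'I_t) : exists w' : 'rV_s,
    (forall k, w' ord0 k \is b.-homog) /\ w' *m D = row i M.
  have [w wD] := rowM i.
  have [|w' [w'h _ w'D]] :=
      @homog_combination _ _ _ _ (fun=> e) (b + e) w D De.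
    by move=> l; rewrite -wD mxE.
  by exists w'; rewrite w'D wD; split=> // k; rewrite -(addnK e b).
exists (\matrix_i W i); split=> [k l|].
  by rewrite mxE; case: (Wok k) => ->.
by apply/row_matrixP => i; rewrite row_mul rowK; case: (Wok i).
Qed.

(** * Linear resolutions and mapping cones *)

(** Unlike [has_linear_resolution], this provides one resolution that
    witnesses all Betti numbers at once, which is what a mapping cone needs. *)
Definition linearly_resolved n (K : fieldType) d (I : {mpoly K[n]} -> Prop) :=
  exists2 F : graded_free_seq n K, minimal_graded_free_resolution I F &
    forall i (k : 'I_(grank F i)), gshift k = (i + d)%N.

(** Minimality comes for free: linear forms have no constant term. *)
Lemma linearly_resolvedI n (K : fieldType) d (I : {mpoly K[n]} -> Prop)
    (r : nat -> nat) (D : forall i, 'M[{mpoly K[n]}]_(r i.+1, r i)) A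
    (F := GradedFreeSeq (fun i (_ : 'I_(r i)) => (i + d)%N) D A) :
  (forall k, A k ord0 \is d.-homog) -> (forall i k l, D i k l \is 1.-homog) ->
  resolves I F -> linearly_resolved d I.
Proof.
move=> Ad D1 resF; exists F => //; split=> //.
  split=> [k|i k l m /(dhomog_mf (D1 i k l)) /= ->]; first exact: Ad.
  by rewrite add1n addSn.
by move=> i k l; apply: (dhomog_nemf_coeff (D1 i k l)); rewrite /= mdeg0.
Qed.

Lemma linear_maps n (K : fieldType) d (F : graded_free_seq n K) :
  graded_maps F -> (forall i (k : 'I_(grank F i)), gshift k = (i + d)%N) ->
  (forall k l, gaug F k l \is d.-homog) /\
  (forall i k l, gdiff F i k l \is 1.-homog).
Proof.
move=> [augF diffF] shF; split=> [k l|i k l].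
  by rewrite ord1; have := augF k; rewrite shF.
apply/dhomogP => m /diffF; rewrite !shF addSn -add1n.
by move/addIn.
Qed.

(** Multiplication by [- u] from L to J lifts to maps between the resolutions
    because the modules of G are free and F is exact. They anticommute with the
    differentials, so that the differential of the cone squares to zero. *)
Lemma comparison_maps n (K : fieldType) d (J L : {mpoly K[n]} -> Prop) u
    (F G : graded_free_seq n K) :
  minimal_graded_free_resolution J F ->
  (forall i (k : 'I_(grank F i)), gshift k = (i + d)%N) ->
  minimal_graded_free_resolution L G ->
  (forall i (k : 'I_(grank G i)), gshift k = (i + 1)%N) ->
  u \is d.-homog -> (forall p, L p -> J (p * u)) ->
  exists phi : forall i, 'M_(grank G i, grank F i),
    [/\ forall i k l, phi i k l \is 1.-homog,
        phi 0%N *m gaug F = - (u *: gaug G) &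
        forall i, phi i.+1 *m gdiff F i = - (gdiff G i *m phi i)].
Proof.
move=> [grF [augF ker0F kerF] _] shF [grG [augG ker0G kerG] _] shG ud LJ.
have [augFd dF1] := linear_maps grF shF; have [augG1 dG1] := linear_maps grG shG.
pose start (psi : 'M_(grank G 0, grank F 0)) :=
  (forall k l, psi k l \is 1.-homog) /\ psi *m gaug F = - (u *: gaug G).
pose next i (psi0 : 'M_(grank G i, grank F i))
      (psi : 'M_(grank G i.+1, grank F i.+1)) :=
  (forall k l, psi k l \is 1.-homog) /\
  psi *m gdiff F i = - (gdiff G i *m psi0).
(* The maps exist only step by step, each depending on the previous one, so
   the sequence is obtained by recursion with a choice at every step. *)
pose phi := fix phi i : 'M_(grank G i, grank F i) :=
  match i with
  | 0 => epsilon (inhabits 0) start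
  | i'.+1 => epsilon (inhabits 0) (next i' (phi i'))
  end.
have startP : start (phi 0%N).
  apply: epsilon_spec; rewrite /start; apply: (homog_lift (e := d)) => // [k l|i].
    by rewrite !mxE dhomogN // mulrC dhomogM.
  have : L (- gaug G i ord0).
    by apply/augG; exists (- delta_mx ord0 i); rewrite mulNmx -rowE !mxE.
  move/LJ/augF => [w wE]; exists w; apply/rowP => l.
  by rewrite ord1 -wE !mxE mulNr mulrC.
have nextP i : (exists psi, next i (phi i) psi) -> next i (phi i) (phi i.+1).
  exact: epsilon_spec.
have lift i : (forall k l, phi i k l \is 1.-homog) ->
    (forall j, exists w, row j (- (gdiff G i *m phi i)) = w *m gdiff F i) ->
    next i (phi i) (phi i.+1).
  move=> phi1 rowi; apply: nextP; rewrite /next.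
  apply: (homog_lift (e := 1)) => // k l; rewrite !mxE dhomogN // rpred_sum // => j _.
  by rewrite dhomogM.
have rowM0 (m p q r : nat) (M : 'M[{mpoly K[n]}]_(m, p)) (N : 'M_(p, q))
   (P : 'M_(q, r)) j : M *m N *m P = 0 -> row j (- (M *m N)) *m P = 0.
  by move=> MN0; rewrite -row_mul mulNmx MN0 oppr0 raddf0.
have dd0G : gdiff G 0 *m gaug G = 0.
  apply/row_matrixP => j; rewrite row_mul row0; apply/ker0G.
  by exists (delta_mx ord0 j); rewrite -rowE.
have ddG i : gdiff G i.+1 *m gdiff G i = 0.
  apply/row_matrixP => j; rewrite row_mul row0; apply/kerG.
  by exists (delta_mx ord0 j); rewrite -rowE.
have phiP i : (forall k l, phi i k l \is 1.-homog) /\ next i (phi i) (phi i.+1).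
  elim: i => [|i [phi1 [phiS1 phiSE]]].
    have [phi1 phiE] := startP; split=> //; apply: lift => // j.
    apply/ker0F/rowM0; rewrite -mulmxA phiE mulmxN -scalemxAr dd0G.
    by rewrite scaler0 oppr0.
  split=> //; apply: lift => // j.
  by apply/kerF/rowM0; rewrite -mulmxA phiSE mulmxN mulmxA ddG mul0mx oppr0.
exists phi; split=> [i k l||i]; first by case: (phiP i) => ->.
  by case: startP.
by case: (phiP i) => _ [].
Qed.

(** The cone of phi : G -> F has F_i + G_(i-1) in degree i, where G_(-1) is a
    copy of the ring whose basis element is mapped to [u]. *)
Definition cone_rank (f g : nat -> nat) i :=
  if i is i'.+1 then (f i + g i')%N else (f 0%N + 1)%N.

Definition cone_diff n (K : fieldType) (F G : graded_free_seq n K)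
    (phi : forall i, 'M_(grank G i, grank F i)) i :
    'M[{mpoly K[n]}]_(cone_rank (grank F) (grank G) i.+1,
                      cone_rank (grank F) (grank G) i) :=
  match i with
  | 0 => block_mx (gdiff F 0) 0 (phi 0%N) (gaug G)
  | i'.+1 => block_mx (gdiff F i'.+1) 0 (phi i'.+1) (gdiff G i')
  end.

(** Exactness is a diagram chase: in a cycle (v, s) of the cone, s is a cycle of
    G, hence a boundary t, and v - t phi is then a cycle of F. In the lowest
    degree, v A + s u = 0 says that s u is in J, that is, s is in L. *)
Lemma mapping_cone n (K : fieldType) d (J L I : {mpoly K[n]} -> Prop) u :
  linearly_resolved d J -> linearly_resolved 1 L -> u \is d.-homog ->
  (forall p, L p <-> colon J u p) ->
  (forall p, I p <-> exists q, J (p - q * u)) ->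
  linearly_resolved d I.
Proof.
move=> [F resF shF] [G resG shG] ud LJ IJ.
have [|phi [phi1 phi0E phiE]] := comparison_maps resF shF resG shG ud.
  by move=> p /LJ.
have [grF [augF ker0F kerF] _] := resF; have [grG [augG ker0G kerG] _] := resG.
have [augFd dF1] := linear_maps grF shF; have [augG1 dG1] := linear_maps grG shG.
have block1 a b c e (M : 'M[{mpoly K[n]}]_(a, c)) (N : 'M_(b, c)) (P : 'M_(b, e)) :
    (forall k l, M k l \is 1.-homog) -> (forall k l, N k l \is 1.-homog) ->
    (forall k l, P k l \is 1.-homog) ->
    forall k l, block_mx M 0 N P k l \is 1.-homog.
  move=> M1 N1 P1 k l; rewrite !mxE.
  case: splitP => k' _; rewrite mxE; case: splitP => l' _ //.
  by rewrite mxE dhomog0.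
(* The diagram chase, common to all positions: [Ma], [N'], [P'] are the maps
   one step to the left of [M], [N], [P]. *)
have kerblock a b c e a' b' (M : 'M[{mpoly K[n]}]_(a, c)) (N : 'M_(b, c))
    (P : 'M_(b, e)) (Ma : 'M_(a', a)) (N' : 'M_(b', a)) (P' : 'M_(b', b)) :
    (forall v : 'rV_a, v *m M = 0 <-> exists w, v = w *m Ma) ->
    (forall v : 'rV_b, v *m P = 0 <-> exists w, v = w *m P') ->
    N' *m M = - (P' *m N) ->
    forall v : 'rV_(a + b), v *m block_mx M 0 N P = 0 <->
      exists w, v = w *m block_mx Ma 0 N' P'.
  move=> kerM kerP comm v; split=> [|[w ->]].
    rewrite -[v]hsubmxK mul_row_block mulmx0 add0r -row_mx0.
    case/eq_row_mx => vM /kerP[t vP].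
    have /kerM[w wE] : (lsubmx v - t *m N') *m M = 0.
      by rewrite mulmxBl -mulmxA comm mulmxN opprK mulmxA -vP.
    exists (row_mx w t); rewrite mul_row_block mulmx0 add0r -vP -wE.
    by rewrite subrK.
  have MM : lsubmx w *m Ma *m M = 0 by apply/kerM; exists (lsubmx w).
  have PP : rsubmx w *m P' *m P = 0 by apply/kerP; exists (rsubmx w).
  rewrite -[w]hsubmxK !mul_row_block !mulmx0 !add0r mulmxDl MM add0r.
  by rewrite -(mulmxA _ N') comm mulmxN mulmxA addNr PP row_mx0.
apply: (@linearly_resolvedI _ _ _ _ _ (cone_diff phi) (col_mx (gaug F) u%:M)).
- move=> k; rewrite mxE; case: splitP => k' _; first exact: augFd.
  by rewrite mxE ord1 eqxx mulr1n.
- by case=> [|i]; apply: block1.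
split=> /=.
- move=> p; split=> [/IJ[q /augF[w wE]]|[v vE]].
    exists (row_mx w q%:M); rewrite mul_row_col mxE -wE -scalar_mxM mxE.
    by rewrite mulr1n subrK.
  apply/IJ; exists (rsubmx v ord0 ord0); apply/augF; exists (lsubmx v).
  move: vE; rewrite -{1}[v]hsubmxK mul_row_col mxE => ->.
  by rewrite mul_mx_scalar [(u *: rsubmx v : 'M__) _ _]mxE [u * _]mulrC addrK.
- move=> v; split=> [|[w ->]].
    rewrite -[v]hsubmxK mul_row_col [rsubmx v]mx11_scalar -scalar_mxM.
    set s := rsubmx v ord0 ord0 => vsu.
    have sL : L s.
      apply/LJ/augF; exists (- lsubmx v).
      move/matrixP/(_ ord0 ord0): vsu; rewrite mulNmx !mxE eqxx !mulr1n.
      by move/eqP; rewrite addrC addr_eq0 => /eqP.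
    have /augG[t tE] := sL.
    have sE : s%:M = t *m gaug G by rewrite tE -mx11_scalar.
    have /ker0F[w wE] : (lsubmx v - t *m phi 0%N) *m gaug F = 0.
      rewrite mulmxBl -mulmxA phi0E mulmxN opprK -scalemxAr -sE.
      by rewrite scale_scalar_mx mulrC.
    exists (row_mx w t); rewrite mul_row_block mulmx0 add0r -sE -wE.
    by rewrite subrK.
  rewrite -[w]hsubmxK mul_row_block mul_row_col mulmx0 add0r mulmxDl.
  rewrite -!mulmxA phi0E.
  have -> : lsubmx w *m (gdiff F 0 *m gaug F) = 0.
    by rewrite mulmxA; apply/ker0F; exists (lsubmx w).
  by rewrite add0r -mulmxDr mul_mx_scalar addNr mulmx0.
case=> [|i].
  by apply: (kerblock _ _ _ _ _ _ _ _ _ _ _ _ (kerF 0%N) ker0G); apply: phiE.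
by apply: (kerblock _ _ _ _ _ _ _ _ _ _ _ _ (kerF i.+1) (kerG i)); apply: phiE.
Qed.

Lemma linearly_resolved0 n (K : fieldType) d (I : {mpoly K[n]} -> Prop) :
  (forall p, I p <-> p = 0) -> linearly_resolved d I.
Proof.
move=> I0; apply: (@linearly_resolvedI _ _ _ _ (fun=> 0%N) (fun=> 0) 0).
- by case.
- by move=> i [].
split=> [p|v|i v] /=.
- rewrite I0; split=> [->|[w ->]]; last by rewrite mulmx0 mxE.
  by exists 0; rewrite mulmx0 mxE.
- split=> _; last by rewrite mulmx0.
  by exists 0; rewrite mulmx0 [v]thinmx0.
split=> _; last by rewrite mulmx0.
by exists 0; rewrite mulmx0 [v]thinmx0.
Qed.

Lemma eq_linearly_resolved n (K : fieldType) d (I J : {mpoly K[n]} -> Prop) :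
  (forall p, I p <-> J p) -> linearly_resolved d I -> linearly_resolved d J.
Proof.
move=> IJ [F [gF [augF ? ?] mF] shF]; exists F => //; split=> //; split=> //.
by move=> p; rewrite -IJ.
Qed.

(** * Ideals with linear quotients *)

(** Membership in A + (u), in the form used by the mapping cone. *)
Lemma ideal_gen_adjoin n (K : fieldType) (A : {mpoly K[n]} -> Prop) u p :
  ideal_gen (fun q => A q \/ q = u) p <-> exists q, ideal_gen A (p - q * u).
Proof.
split=> [[s [sA ->]]|[q Apq]].
  elim: s sA => [|c s IHs] sA.
    by exists 0; rewrite big_nil mul0r subr0; apply: ideal_gen0.
  have [|q Aq] := IHs; first by move=> c' sc'; apply: sA; rewrite inE sc' orbT.
  rewrite big_cons; case: (sA c (mem_head _ _)) => [Ac|->].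
    exists q; rewrite -addrA; apply: ideal_genD => //.
    exact/ideal_genM/ideal_gen_incl.
  by exists (c.1 + q); rewrite mulrDl opprD addrACA subrr add0r.
rewrite -(subrK (q * u) p); apply: ideal_genD.
  by apply: ideal_gen_sub Apq => r Ar; apply: ideal_gen_incl; left.
by apply/ideal_genM/ideal_gen_incl; right.
Qed.

Lemma variable_ideal_set0 n (K : fieldType) (p : {mpoly K[n]}) :
  variable_ideal set0 p <-> p = 0.
Proof.
rewrite variable_idealP; split=> [p0|-> m]; last by rewrite msupp0.
by apply: supp_eq0 => m; apply/negP => /p0[k]; rewrite inE.
Qed.

(** Removing a variable x from V leaves an ideal modulo which x is a
    nonzerodivisor, so this ideal serves both as J and as (J : x) in the cone. *)
Lemma variable_ideal_linearly_resolved n (K : fieldType) (V : {set 'I_n}) :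
  linearly_resolved 1 (variable_ideal (K := K) V).
Proof.
have [c] := ubnP #|V|; elim: c V => // c IHc V.
have [->|[x Vx]] := set_0Vmem V => [_|].
  by apply: linearly_resolved0 => p; apply: variable_ideal_set0.
rewrite (cardsD1 x V) Vx ltnS => /IHc V'res.
apply: (mapping_cone (u := 'X_x) V'res V'res).
- by rewrite dhomogX /= mdeg1.
- move=> p; rewrite /colon !variable_idealP.
  have addE (m : 'X_{1..n}) k : k \in V :\ x -> (U_(x) + m)%MM k = m k.
    by rewrite !inE mnmDE mnm1E eq_sym => /andP[/negPf -> _].
  split=> Vp m.
    rewrite (perm_mem (msuppMX _ _)) => /mapP[m' /Vp[k Vk mk] ->].
    by exists k; rewrite ?addE.
  move=> pm; have [|k Vk mk] := Vp (U_(x) + m)%MM.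
    by rewrite (perm_mem (msuppMX _ _)) map_f.
  by exists k; rewrite // -(addE m).
move=> p; rewrite -ideal_gen_adjoin; apply: eq_ideal_gen => q.
split=> [[k Vk ->]|[[k]|->]]; last by exists x.
  by have [->|ne] := eqVneq k x; [right | left; exists k; rewrite // !inE ne].
by rewrite !inE => /andP[_ Vk] ->; exists k.
Qed.

Lemma linear_quotients_linearly_resolved n (K : fieldType) d
    (s : seq 'X_{1..n}) :
  (forall m, m \in s -> mdeg m = d) ->
  (forall i, (0 < i < size s)%N -> exists V : {set 'I_n},
     forall p : {mpoly K[n]},
       colon (monomial_ideal_gen (take i s)) 'X_[nth 0%MM s i] p <->
       variable_ideal V p) ->
  linearly_resolved d (monomial_ideal_gen (K := K) s).
Proof.
move=> sd sV; rewrite -[s]take_size.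
have: (size s <= size s)%N by []; elim: {1 3}(size s) => [_|i IHi ltis].
  apply: linearly_resolved0 => p; rewrite take0 monomial_ideal_genP.
  split=> [p0|-> m]; last by rewrite msupp0.
  by apply: supp_eq0 => m; apply/negP => /p0[].
have [V VE] : exists V : {set 'I_n}, forall p : {mpoly K[n]},
    colon (monomial_ideal_gen (take i s)) 'X_[nth 0%MM s i] p <->
    variable_ideal V p.
  (* The definition of linear quotients starts at the second generator; for
     the first one, the colon ideal of 0 is 0. *)
  have [i0|i_gt0] := posnP i; last by apply: sV; apply/andP.
  exists set0 => p; rewrite i0 take0 /colon variable_ideal_set0 monomial_idealMX.
  split=> [p0|-> m]; last by rewrite msupp0.
  by apply: supp_eq0 => m; apply/negP => /p0[].
apply: (mapping_cone (u := 'X_[nth 0%MM s i]) (IHi (ltnW ltis))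
                     (variable_ideal_linearly_resolved K V)).
- by rewrite dhomogX; apply/eqP/sd/mem_nth.
- by move=> p; rewrite VE.
move=> p; rewrite -ideal_gen_adjoin (take_nth 0%MM) //; apply: eq_ideal_gen => q.
split=> [[m]|[[m sm ->]|->]].
- by rewrite mem_rcons inE => /orP[/eqP->|sm] ->; [right | left; exists m].
- by exists m; rewrite // mem_rcons inE sm orbT.
by exists (nth 0%MM s i); rewrite // mem_rcons inE eqxx.
Qed.

Lemma linearly_resolved_monomial n (K : fieldType) d (s : seq 'X_{1..n})
    (I : {mpoly K[n]} -> Prop) :
  (forall m, m \in s -> mdeg m = d) ->
  (forall p, I p <-> monomial_ideal_gen s p) ->
  linearly_resolved d I -> has_linear_resolution I.
Proof.
move=> sd Is [F resF shF]; exists d; split.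
  exists [seq 'X_[m] | m <- s]; split=> [p /mapP[m /sd md ->]|p].
    by rewrite dhomogX /= md.
  rewrite Is; apply: eq_ideal_gen => q; split=> [[m sm ->]|/mapP[m sm ->]].
    exact: map_f.
  by exists m.
move=> i j neij; exists F => //; apply/eqP; rewrite cards_eq0 -subset0.
by apply/subsetP => k; rewrite !inE shF eq_sym (negPf neij).
Qed.

(** Minimal monomial generators are unique: m is divisible by an edge
    monomial, which is in turn divisible by some element of s; by minimality
    the latter is m itself. *)
Lemma minimal_generator_edge n (K : fieldType) (G : rel 'I_n) s m :
  minimal_monomial_generators (compl_edge_ideal K G) s -> m \in s ->
  exists2 e, e \in edges G & m = compl_monomial e.
Proof.
move=> [Is s_min] sm.
have : compl_edge_ideal K G 'X_[m].
  by apply/Is/monomial_ideal_genX; exists m => //; apply: lepm_refl.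
case/compl_edge_idealP/(_ m) => [|e eG em]; first by rewrite msuppX mem_head.
exists e => //; apply: lem_antisym => //.
have := compl_edge_ideal_edge K eG.
case/Is/monomial_ideal_genX => m' sm' m'e.
have [<- //|nem] := eqVneq m' m.
case: (s_min m sm); apply/monomial_ideal_genX; exists m'.
  by move: sm'; rewrite (perm_mem (perm_to_rem sm)) inE (negPf nem).
exact: lepm_trans em.
Qed.

Lemma linear_quotients_linear_resolution n (K : fieldType) (G : rel 'I_n) :
  irreflexive G -> has_linear_quotients (compl_edge_ideal K G) ->
  has_linear_resolution (compl_edge_ideal K G).
Proof.
move=> Girr [s [s_min sV]].
have sd m : m \in s -> mdeg m = n.-2.
  by case/(minimal_generator_edge s_min) => e /(mdeg_compl_monomial_edge Girr) <- ->.
case: (s_min) => Is _; apply: (linearly_resolved_monomial sd Is).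
apply: eq_linearly_resolved (linear_quotients_linearly_resolved sd sV) => p.
by rewrite Is.
Qed.

Lemma linear_resolution_related n (K : fieldType) (I : {mpoly K[n]} -> Prop) :
  has_linear_resolution I -> linearly_related I.
Proof. by move=> [d [Id betti]]; exists d; split=> // j nej; apply: betti; rewrite add1n. Qed.

(** * Disconnected graphs have a nonlinear syzygy *)

Definition restrict n (K : fieldType) (P : pred 'X_{1..n}) (p : {mpoly K[n]}) :=
  \sum_(m <- msupp p | P m) p@_m *: 'X_[m].

Lemma mcoeff_restrict n (K : fieldType) (P : pred 'X_{1..n}) (p : {mpoly K[n]}) m :
  (restrict P p)@_m = if P m then p@_m else 0.
Proof.
rewrite raddf_sum /=.
rewrite (eq_bigr (fun m' => if m' == m then p@_m else 0)); last first.
  by move=> m' _; rewrite mcoeffZ mcoeffX; case: eqP => [->|_]; rewrite ?mulr1 ?mulr0.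
rewrite -big_mkcondr /=; have [pm|pm] := boolP (m \in msupp p).
  case: ifP => Pm.
    rewrite big_mkcond (bigD1_seq m) //= Pm eqxx big1 ?addr0 // => m' /negPf ->.
    by rewrite andbF.
  by rewrite big1 // => m' /andP[Pm' /eqP m'm]; rewrite m'm Pm in Pm'.
by rewrite (memN_msupp_eq0 pm) if_same big1.
Qed.

Lemma restrictD n (K : fieldType) (P : pred 'X_{1..n}) (p q : {mpoly K[n]}) :
  restrict P (p + q) = restrict P p + restrict P q.
Proof.
apply/mpolyP => m; rewrite mcoeffD !mcoeff_restrict mcoeffD.
by case: (P m); rewrite ?addr0.
Qed.

Lemma restrict0 n (K : fieldType) (P : pred 'X_{1..n}) : restrict P (0 : {mpoly K[n]}) = 0.
Proof. by apply/mpolyP => m; rewrite mcoeff_restrict mcoeff0 if_same. Qed.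

Lemma restrict_sum n (K : fieldType) (P : pred 'X_{1..n}) r (f : 'I_r -> {mpoly K[n]}) :
  restrict P (\sum_k f k) = \sum_k restrict P (f k).
Proof.
by elim/big_rec2: _ => [|k p q _ <-]; rewrite ?restrict0 // restrictD.
Qed.

Lemma restrict_all n (K : fieldType) (P : pred 'X_{1..n}) (p : {mpoly K[n]}) :
  {in msupp p, forall m, P m} -> restrict P p = p.
Proof.
move=> pP; apply/mpolyP => m; rewrite mcoeff_restrict.
have [/pP -> //|/memN_msupp_eq0 ->] := boolP (m \in msupp p).
by rewrite if_same.
Qed.

Lemma restrict_none n (K : fieldType) (P : pred 'X_{1..n}) (p : {mpoly K[n]}) :
  {in msupp p, forall m, ~~ P m} -> restrict P p = 0.
Proof.
move=> pP; apply/mpolyP => m; rewrite mcoeff_restrict mcoeff0.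
have [/pP/negPf -> //|/memN_msupp_eq0 ->] := boolP (m \in msupp p).
by rewrite if_same.
Qed.

Lemma msupp_restrict n (K : fieldType) (P : pred 'X_{1..n}) (p : {mpoly K[n]}) m :
  m \in msupp (restrict P p) -> P m && (m \in msupp p).
Proof. by rewrite !mcoeff_msupp mcoeff_restrict; case: (P m); rewrite ?eqxx. Qed.

Definition misses n (C : pred 'I_n) : pred 'X_{1..n} :=
  fun m => [exists i, (i \in C) && (m i == 0%N)].

Lemma mdeg_le1 n (m : 'X_{1..n}) i j :
  (mdeg m <= 1)%N -> i != j -> (m i == 0%N) || (m j == 0%N).
Proof.
move=> m1 neij; rewrite -[_ || _]negbK negb_or -!lt0n; apply/andP => -[mi mj].
move: m1; apply/negP; rewrite -ltnNge mdegE (bigD1 i) //= (bigD1 j) 1?eq_sym //=.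
by apply: (leq_add mi); apply: leq_trans mj (leq_addr _ _).
Qed.

(** The key to the disconnected case. The truncation keeps u_e exactly when e
    lies inside C. Multiplying such a u_e by a variable still leaves one of the
    two vertices of e uncovered; and no multiple of another u_e is kept, since
    the vertices that it misses lie outside C. *)
Lemma restrict_mul_linear n (K : fieldType) (G : rel 'I_n) C
    (l p : {mpoly K[n]}) :
  irreflexive G -> (forall x y, G x y -> (x \in C) = (y \in C)) ->
  {in msupp l, forall m, (mdeg m <= 1)%N} ->
  {in msupp p, forall m, exists2 e, e \in edges G & m = compl_monomial e} ->
  restrict (misses C) (l * p) = l * restrict (misses C) p.
Proof.
move=> Girr Cclosed l1 pG.
have splitp : p = restrict (misses C) p + restrict (predC (misses C)) p.
  apply/mpolyP => m; rewrite mcoeffD !mcoeff_restrict /=.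
  by case: (misses C m); rewrite ?addr0 ?add0r.
rewrite {1}splitp mulrDr restrictD restrict_all; last first.
  move=> _ /msuppMP[m1 [m2 [lm1 /msupp_restrict/andP[Cm2 pm2] ->]]].
  have [_ /edgesP[i [j [Gij ->]]] m2E] := pG _ pm2.
  have neij : i != j by apply: contraTneq Gij => ->; rewrite Girr.
  have [Ci Cj] : i \in C /\ j \in C.
    have /existsP[k /andP[Ck]] := Cm2; have Cij := Cclosed _ _ Gij.
    rewrite m2E compl_monomial_eq0 !inE.
    by case/orP=> /eqP kE; move: Ck Cij; rewrite kE => -> // <-.
  apply/existsP; case/orP: (mdeg_le1 (l1 _ lm1) neij) => m10.
    by exists i; rewrite Ci mnmDE (eqP m10) m2E compl_monomial_eq0 set21.
  by exists j; rewrite Cj mnmDE (eqP m10) m2E compl_monomial_eq0 set22.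
rewrite [X in _ + X]restrict_none ?addr0 //.
move=> _ /msuppMP[m1 [m2 [_ /msupp_restrict/andP[Cm2 _] ->]]].
apply: contra Cm2 => /existsP[i /andP[Ci]]; rewrite mnmDE addn_eq0.
by case/andP=> _ m2i; apply/existsP; exists i; rewrite Ci.
Qed.

Lemma compl_edge_ideal_mdeg n (K : fieldType) (G : rel 'I_n) (p : {mpoly K[n]}) m :
  irreflexive G -> compl_edge_ideal K G p -> m \in msupp p ->
  (n.-2 <= mdeg m)%N.
Proof.
move=> Girr /compl_edge_idealP Ip /Ip[e /(mdeg_compl_monomial_edge Girr) <-].
by case/lem_exists_add=> m' ->; rewrite mdegD leq_addl.
Qed.

(** The degree d in which the ideal is generated is not given, so it has to be
    identified before the Betti numbers can be used. *)
Lemma compl_edge_ideal_degree n (K : fieldType) (G : rel 'I_n) e d :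
  irreflexive G -> e \in edges G ->
  generated_in_degree (compl_edge_ideal K G) d -> d = n.-2.
Proof.
move=> Girr eG [s [sd Is]]; apply/eqP; rewrite eqn_leq.
have ue : ideal_gen (fun q => q \in s) ('X_[compl_monomial e] : {mpoly K[n]}).
  exact/Is/compl_edge_ideal_edge.
apply/andP; split.
  rewrite -(mdeg_compl_monomial_edge Girr eG).
  pose Q (p : {mpoly K[n]}) := forall m, m \in msupp p -> (d <= mdeg m)%N.
  suff: Q 'X_[compl_monomial e] by apply; rewrite msuppX mem_head.
  move: ue; apply: ideal_gen_ind => [m|p q Qp Qq m|q p sp m].
  - by rewrite msupp0.
  - by move/msuppD_le; rewrite mem_cat => /orP[/Qp|/Qq].
  by case/msuppMP=> m1 [m2 [_ /(dhomog_mf (sd _ sp)) /= <- ->]]; rewrite mdegD leq_addl.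
have /hasP[q sq q0] : has (fun q => q != 0) s.
  apply/negPn/negP => /hasPn s0.
  have : 'X_[compl_monomial e] = 0 :> {mpoly K[n]}.
    apply: (ideal_gen_ind (Q := fun p => p = 0)) ue => // [p q -> ->|q p /s0]; first by rewrite addr0.
    by rewrite negbK => /eqP ->; rewrite mulr0.
  by move/eqP; rewrite -msupp_eq0 msuppX.
have [m qm] : exists m, m \in msupp q.
  by move: q0; rewrite -msupp_eq0; case: (msupp q) => // m r _; exists m; rewrite mem_head.
rewrite -(dhomog_mf (sd _ sq) qm) /=; apply: compl_edge_ideal_mdeg Girr _ qm.
by apply/Is; apply: ideal_gen_incl.
Qed.

(** Syzygies on a minimal system of generators have no constant terms. *)
Lemma minimal_syzygy n (K : fieldType) (I : {mpoly K[n]} -> Prop)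
    (F : graded_free_seq n K) (v : 'rV_(grank F 0)) k :
  minimal_graded_free_resolution I F -> v *m gaug F = 0 ->
  (v ord0 k)@_0%MM = 0.
Proof.
move=> [_ [_ ker0 _] minF] /ker0[w ->]; rewrite mxE raddf_sum /= big1 // => l _.
by rewrite rmorphM /= minF mulr0.
Qed.

(** For degree reasons an edge monomial is a scalar combination of those
    generators that have the lowest possible degree. *)
Lemma edge_combination n (K : fieldType) (G : rel 'I_n)
    (F : graded_free_seq n K) e :
  irreflexive G -> minimal_graded_free_resolution (compl_edge_ideal K G) F ->
  e \in edges G -> exists a : 'rV_(grank F 0),
    [/\ a *m gaug F = 'X_[compl_monomial e]%:M,
        forall k, {in msupp (a ord0 k), forall m, (mdeg m <= 1)%N} &
        forall k, (n.-2 < gshift k)%N -> a ord0 k = 0].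
Proof.
move=> Girr [[augh _] [augF _ _] _] eG.
have /augF[w wE] := compl_edge_ideal_edge K eG.
have wM : w *m gaug F = 'X_[compl_monomial e]%:M by rewrite [LHS]mx11_scalar -wE.
have shiftge k : gaug F k ord0 != 0 -> (n.-2 <= gshift (i := 0) k)%N.
  rewrite -msupp_eq0; case E: (msupp _) => [//|m r] _.
  have km : m \in msupp (gaug F k ord0) by rewrite E mem_head.
  rewrite -(dhomog_mf (augh k) km); apply: compl_edge_ideal_mdeg Girr _ km.
  by apply/augF; exists (delta_mx ord0 k); rewrite -rowE mxE.
have [| |a [ah a0 aE]] := @homog_combination _ _ _ _ (gshift (i := 0)) n.-2 w (gaug F).
- by move=> k l; rewrite ord1.
- move=> l; rewrite wM [l]ord1 mxE eqxx mulr1n dhomogX.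
  by rewrite /= (mdeg_compl_monomial_edge Girr eG).
(* A zero generator could have a shift below n - 2, which would allow a
   nonconstant coefficient; its coefficient is set to zero. *)
exists (\row_k if gaug F k ord0 == 0 then 0 else a ord0 k); split.
- rewrite -wM -aE; apply/matrixP => i j; rewrite !ord1 !mxE; apply: eq_bigr => k _.
  by rewrite mxE; case: eqP => // ->; rewrite !mulr0.
- move=> k m; rewrite mxE; case: eqP => [_|/eqP/shiftge le]; first by rewrite msupp0.
  move/(dhomog_mf (ah k)) => /= ->; move: le; rewrite -subn_eq0 => /eqP ->.
  by [].
by move=> k /a0 ak; rewrite mxE ak if_same.
Qed.

(** A basis element of smaller degree would map to 0, and one of larger degree
    to a combination of the others, by [edge_combination]; both give a syzygy
    with coefficient 1, against minimality. *)
Lemma generator_shift n (K : fieldType) (G : rel 'I_n)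
    (F : graded_free_seq n K) (k : 'I_(grank F 0)) :
  irreflexive G -> minimal_graded_free_resolution (compl_edge_ideal K G) F ->
  gshift k = n.-2.
Proof.
move=> Girr minF; have [[augh _] [augF _ _] _] := minF.
have Ik : compl_edge_ideal K G (gaug F k ord0).
  by apply/augF; exists (delta_mx ord0 k); rewrite -rowE mxE.
apply/eqP; rewrite eqn_leq; apply/andP; split; last first.
  have [k0|] := eqVneq (gaug F k ord0) 0.
    have /(minimal_syzygy k minF) : delta_mx (ord0 : 'I_1) k *m gaug F = 0.
      by rewrite -rowE; apply/rowP => l; rewrite [l]ord1 !mxE.
    by rewrite mxE !eqxx mcoeff1 eqxx => /eqP; rewrite oner_eq0.
  rewrite -msupp_eq0; case E: (msupp _) => [//|m r] _.
  have km : m \in msupp (gaug F k ord0) by rewrite E mem_head.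
  by rewrite -(dhomog_mf (augh k) km); apply: compl_edge_ideal_mdeg Girr Ik km.
rewrite leqNgt; apply/negP => shift_gt.
have [v [vk vE]] : exists v : 'rV_(grank F 0),
    v ord0 k = 0 /\ v *m gaug F = (gaug F k ord0)%:M.
  move: (gaug F k ord0) Ik; apply: ideal_gen_ind.
  - by exists 0; rewrite mxE mul0mx -scalemx1 scale0r.
  - move=> p q [v [vk vE]] [w [wk wE]]; exists (v + w).
    by rewrite mxE vk wk addr0 mulmxDl vE wE raddfD.
  move=> c p [i [j [Gij pE]]].
  have eG : [set i; j] \in edges G by apply/edgesP; exists i, j.
  have [a [aE _ a0]] := edge_combination Girr minF eG.
  exists (c *: a); rewrite mxE a0 // mulr0 -scalemxAl aE scale_scalar_mx.
  by rewrite pE prod_edge_monomial.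
have /(minimal_syzygy k minF) : (delta_mx ord0 k - v) *m gaug F = 0.
  rewrite mulmxBl vE -rowE; apply/rowP => l.
  by rewrite [l]ord1 !mxE eqxx mulr1n subrr.
by rewrite !mxE !eqxx vk subr0 mcoeff1 eqxx => /eqP; rewrite oner_eq0.
Qed.

Lemma linearly_related_connected n (K : fieldType) (G : rel 'I_n) :
  (1 < n)%N -> ssrbool.symmetric G -> irreflexive G ->
  (forall i, exists j, G i j) -> linearly_related (compl_edge_ideal K G) ->
  forall i j, connect G i j.
Proof.
move=> n_gt1 Gsym Girr Gno [d [dgen betti]] x y.
have [//|ncxy] := boolP (connect G x y).
have [x' Gx] := Gno x; have [y' Gy] := Gno y.
have eG : [set x; x'] \in edges G by apply/edgesP; exists x, x'.
have fG : [set y; y'] \in edges G by apply/edgesP; exists y, y'.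
have dE := compl_edge_ideal_degree Girr eG dgen.
have [|F minF noshift] := betti n.
  by rewrite dE; case: (n) n_gt1 => [|[|m]] //= _; rewrite neq_ltn ltnSn orbT.
have [[augh diffh] [augF ker0F _] _] := minF.
pose C : pred 'I_n := connect G x.
have Cclosed u v : G u v -> (u \in C) = (v \in C).
  exact: connect_closed (sym_connect_sym Gsym) x u v.
pose P := misses C.
have augk k : {in msupp (gaug F k ord0), forall m,
    exists2 e, e \in edges G & m = compl_monomial e}.
  move=> m km; have /compl_edge_idealP : compl_edge_ideal K G (gaug F k ord0).
    by apply/augF; exists (delta_mx ord0 k); rewrite -rowE mxE.
  case/(_ _ km) => e eG' em; exists e => //; apply/esym/lem_mdeg_eq => //.
  rewrite (mdeg_compl_monomial_edge Girr eG') -(generator_shift k Girr minF).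
  exact/esym/(dhomog_mf (augh k) km).
(* [A] lists the truncated generators. By [linA] every row with entries of
   degree at most 1 that is a syzygy of the generators is one of [A]. *)
pose A := \col_k restrict P (gaug F k ord0).
have linA r (M : 'M_(r, grank F 0)) i :
    (forall k, {in msupp (M i k), forall m, (mdeg m <= 1)%N}) ->
    (M *m A) i ord0 = restrict P ((M *m gaug F) i ord0).
  move=> M1; rewrite !mxE restrict_sum; apply: eq_bigr => k _.
  by rewrite mxE -(restrict_mul_linear Girr Cclosed (M1 k) (augk k)).
have [a [aE a1 _]] := edge_combination Girr minF eG.
have [b [bE b1 _]] := edge_combination Girr minF fG.
(* The complementary monomial of the empty set is x_1 ... x_n. *)
pose top : 'X_{1..n} := compl_monomial set0.
have topE g : (compl_monomial (~: g) + compl_monomial g)%MM = top.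
  by apply/mnmP => k; rewrite mnmDE !compl_monomialE !inE negbK; case: (k \in g).
pose v := 'X_[compl_monomial (~: [set x; x'])] *: a - 'X_[compl_monomial (~: [set y; y'])] *: b.
have v0 : v *m gaug F = 0.
  rewrite mulmxBl -!scalemxAl aE bE !scale_scalar_mx -!mpolyXD !topE subrr //.
have aA : a *m A = 'X_[compl_monomial [set x; x']]%:M.
  apply/matrixP => i j; rewrite !ord1 linA // aE !mxE restrict_all // => m.
  rewrite msuppX inE => /eqP ->; apply/existsP; exists x.
  by rewrite compl_monomial_eq0 set21 andbT; apply: connect0.
have bA : b *m A = 0.
  apply/matrixP => i j; rewrite !ord1 linA // bE !mxE restrict_none // => m.
  rewrite msuppX inE => /eqP ->; apply/existsPn => z.
  rewrite compl_monomial_eq0; apply/negP => /andP[Cz].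
  rewrite !inE => yz; case/negP: ncxy; rewrite -[connect G x y]/(y \in C).
  by case/orP: yz => /eqP zE; [rewrite -zE | rewrite (Cclosed _ _ Gy) -zE].
have vA : (v *m A) ord0 ord0 = 'X_[top].
  rewrite mulmxBl -!scalemxAl aA bA scaler0 subr0 scale_scalar_mx -mpolyXD topE.
  by rewrite mxE.
(* The rows of the second map of degree at most n - 1 have linear entries and
   annihilate [A]; those of degree more than n only produce monomials of
   degree more than n. So x_1 ... x_n cannot occur. *)
have := congr1 (mcoeff top) vA; rewrite mcoeffX eqxx.
have /ker0F[w ->] := v0; rewrite -mulmxA mxE raddf_sum /= big1.
  by move/esym/eqP; rewrite oner_eq0.
move=> l _; apply: memN_msupp_eq0; apply/negP => /msuppMP[m1 [m2 [_ Dm2 topm]]].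
have degtop : mdeg top = n by rewrite mdeg_compl_monomial cards0 subn0.
have [le_ln|lt_nl] := leqP (gshift l) n.-1.
  move: Dm2; rewrite linA => [|k m /diffh].
    have -> : gdiff F 0 *m gaug F = 0.
      apply/row_matrixP => j; rewrite row_mul row0; apply/ker0F.
      by exists (delta_mx ord0 j); rewrite -rowE.
    by rewrite mxE restrict0 msupp0.
  rewrite (generator_shift k Girr minF) => mE.
  have n1 : n.-1 = (1 + n.-2)%N by case: (n) n_gt1 => [|[|n']].
  by move: le_ln; rewrite -mE n1 leq_add2r.
have lt_nl' : (n < gshift l)%N.
  rewrite ltn_neqAle; apply/andP; split; last exact: leq_trans (leqSpred n) lt_nl.
  apply/eqP => nl; move: noshift; apply/eqP; rewrite -lt0n; apply/card_gt0P.
  by exists l; rewrite inE eq_sym; apply/eqP.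
have : (n < mdeg top)%N.
  rewrite topm mdegD; apply: leq_trans (leq_addl _ _).
  move: Dm2; rewrite mxE => /msupp_sum_le/flattenP[t /mapP[k _ ->]].
  case/msuppMP=> m3 [m4 [/diffh Dm3]]; rewrite mxE => /msupp_restrict/andP[_ km4] ->.
  by rewrite mdegD (dhomog_mf (augh k) km4) Dm3.
by rewrite degtop ltnn.
Qed.

(** * Linear quotients for connected graphs *)

(** The list is grown greedily. If no edge outside s meets the set W of
    vertices covered by s, then W is closed under adjacency, hence everything
    by connectedness, and there is no edge left. *)
Lemma connected_edge_order n (G : rel 'I_n) :
  ssrbool.symmetric G -> (forall i j, connect G i j) ->
  exists s : seq {set 'I_n}, [/\ uniq s, s =i edges G &
    forall i, (0 < i < size s)%N ->
      exists2 f, f \in take i s & f :&: nth set0 s i != set0].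
Proof.
move=> Gsym Gconn.
have extend s : {subset s <= edges G} -> uniq s -> (size s < #|edges G|)%N ->
    exists e, [/\ e \in edges G, e \notin s &
      (0 < size s)%N -> exists2 f, f \in s & f :&: e != set0].
  move=> sG s_uniq lts.
  have [e eG es] : exists2 e, e \in edges G & e \notin s.
    apply/subsetPn; apply: contraL lts => /subset_leq_card.
    by rewrite -leqNgt (card_uniqP s_uniq).
  pose W := [pred x | has (fun f : {set 'I_n} => x \in f) s].
  have [/exists_inP[e' e'G /andP[e's /exists_inP[x xe' /hasP[f sf xf]]]]|] :=
    boolP [exists e' in edges G, (e' \notin s) && [exists x in e', W x]].
    exists e'; split=> // _; exists f => //.
    by apply/set0Pn; exists x; rewrite inE xf.
  rewrite negb_exists_in => /forall_inP noW; exists e; split=> // s_gt0.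
  have Wclosed : closed G W.
    apply: intro_closed; first exact: sym_connect_sym.
    move=> x y Gxy Wx; have xyG : [set x; y] \in edges G.
      by apply/edgesP; exists x, y.
    move: (noW _ xyG); rewrite negb_and negbK => /orP[sxy|/exists_inPn/(_ x)].
      by apply/hasP; exists [set x; y]; rewrite // set22.
    by rewrite set21 => /(_ isT)/negP[].
  have edge_mem f : f \in edges G -> exists x, x \in f.
    by case/edgesP => x [y [_ ->]]; exists x; rewrite set21.
  have f0s : nth set0 s 0 \in s by apply: mem_nth.
  have [x0 x0f] := edge_mem _ (sG _ f0s); have [x xe] := edge_mem _ eG.
  have /hasP[f sf xf] : W x.
    rewrite -[W x]/(x \in W) -(closed_connect Wclosed (Gconn x0 x)).
    by apply/hasP; exists (nth set0 s 0).
  by exists f => //; apply/set0Pn; exists x; rewrite inE xf.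
have : forall k, (k <= #|edges G|)%N -> exists s : seq {set 'I_n},
    [/\ uniq s, {subset s <= edges G}, size s = k &
    forall i, (0 < i < size s)%N ->
      exists2 f, f \in take i s & f :&: nth set0 s i != set0].
  elim=> [_|k IHk ltk]; first by exists [::]; split=> // i; rewrite andbF.
  have [s [s_uniq sG sk s_ok]] := IHk (ltnW ltk).
  have [|e [eG es e_ok]] := extend s sG s_uniq; first by rewrite sk.
  exists (rcons s e); split; rewrite ?rcons_uniq ?es ?size_rcons ?sk //.
    by move=> f; rewrite mem_rcons inE => /orP[/eqP ->|/sG].
  move=> i /andP[i_gt0]; rewrite ltnS leq_eqVlt => /orP[/eqP ik|ltik].
    rewrite ik nth_rcons sk ltnn eqxx -cats1 -{1}sk take_size_cat //.
    have [|f sf fe] := e_ok; last by exists f.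
    by rewrite sk -ik.
  have [|f fi fe] := s_ok i; first by rewrite i_gt0 sk.
  exists f; rewrite ?nth_rcons ?sk ?ltik // -cats1 takel_cat //.
  by rewrite sk ltnW.
case/(_ _ (leqnn _)) => s [s_uniq sG sk s_ok]; exists s; split=> //.
by apply/subset_cardP; [rewrite (card_uniqP s_uniq) | apply/subsetP].
Qed.

(** This is u_f : u_e = product of the x_k for k in e but not in f. *)
Lemma compl_monomial_le_add n (e f : {set 'I_n}) m :
  (compl_monomial f <= m + compl_monomial e)%MM <-> forall k, k \in e :\: f -> (0 < m k)%N.
Proof.
split=> [/mnm_lepP le k|m_gt0].
  by rewrite inE => /andP[kf ke]; have := le k; rewrite mnmDE !compl_monomialE kf ke addn0.
apply/mnm_lepP => k; rewrite mnmDE !compl_monomialE.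
have [kf|kf] := boolP (k \in f) => //; have [ke|ke] := boolP (k \in e) => /=.
  by rewrite addn0 m_gt0 // inE kf.
by rewrite addn1.
Qed.

Lemma edge_diff n (G : rel 'I_n) e f : irreflexive G ->
  e \in edges G -> f \in edges G -> f != e -> f :&: e != set0 ->
  exists x, e :\: f = [set x].
Proof.
move=> Girr eG fG nefe; rewrite -card_gt0 => fe_gt0.
have e2 := cards_edge Girr eG; have f2 := cards_edge Girr fG.
apply/cards1P; rewrite cardsD e2 setIC.
have : (#|f :&: e| <= 2)%N by rewrite -f2 subset_leq_card ?subsetIl.
case fe: #|f :&: e| fe_gt0 => [|[|[|c]]] // _ _.
case/eqP: nefe; have /eqP fE : f :&: e == f.
  by rewrite eqEcard subsetIl f2 fe.
by apply/eqP; rewrite eqEcard e2 f2 leqnn -fE subsetIr.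
Qed.

Lemma connected_linear_quotients n (K : fieldType) (G : rel 'I_n) :
  ssrbool.symmetric G -> irreflexive G -> (forall i j, connect G i j) ->
  has_linear_quotients (compl_edge_ideal K G).
Proof.
move=> Gsym Girr Gconn.
have [s [s_uniq sG s_ok]] := connected_edge_order Gsym Gconn.
have s'_uniq : uniq [seq compl_monomial e | e <- s].
  by rewrite map_inj_uniq //; apply: compl_monomial_inj.
exists [seq compl_monomial e | e <- s]; split; first split.
- move=> p; rewrite compl_edge_idealP monomial_ideal_genP.
  split=> Ip m /Ip[].
    by move=> e eG em; exists (compl_monomial e) => //; rewrite map_f ?sG.
  by move=> _ /mapP[e se ->] em; exists e; rewrite -?sG.
- move=> m /mapP[e se ->] /monomial_ideal_genX[m'].
  rewrite mem_rem_uniq // => /andP[nem /mapP[f sf m'E]]; rewrite m'E => le.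
  case/eqP: nem; rewrite m'E; congr compl_monomial; apply/esym/eqP.
  rewrite eqEcard !(cards_edge Girr) -?sG // andbT; apply/subsetP => k ke.
  by move/mnm_lepP/(_ k): le; rewrite !compl_monomialE ke leqn0 eqb0 negbK.
move=> i; rewrite size_map => i_ok; have /andP[i_gt0 ltis] := i_ok.
set e := nth set0 s i; have se : e \in s by apply: mem_nth.
have take_s f : f \in take i s -> (f \in s) && (f != e).
  move=> fi; rewrite (mem_take fi) /=; apply: contraTneq fi => ->.
  move: s_uniq; rewrite -{1}(cat_take_drop i s) (drop_nth set0) //.
  by rewrite cat_uniq => /and3P[_ /hasPn/(_ e (mem_head _ _))].
have diff f : f \in take i s -> f :&: e != set0 -> exists x, e :\: f = [set x].
  by move=> /take_s/andP[sf nefe]; apply: (edge_diff Girr); rewrite -?sG.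
exists [set x | has (fun f => e :\: f == [set x]) (take i s)] => p.
rewrite /colon (nth_map set0) // -/e -map_take monomial_idealMX variable_idealP.
split=> sp m pm.
  have [_ /mapP[f fi ->] /compl_monomial_le_add le] := sp m pm.
  (* If f is disjoint from e, replace it by an earlier edge f' meeting e: the
     remaining vertex of e belongs to e, which is all of e minus f. *)
  have [f' [f'i f'e sub]] : exists f', [/\ f' \in take i s, f' :&: e != set0 &
      e :\: f' \subset e :\: f].
    have [fe0|fe] := eqVneq (f :&: e) set0; last by exists f.
    have [f' f'i f'e] := s_ok i i_ok; exists f'; split=> //.
    rewrite [e :\: f](_ : _ = e) ?subsetDl //.
    by apply/setDidPl; rewrite -setI_eq0 setIC fe0.
  have [x xE] := diff f' f'i f'e; exists x.
    by rewrite inE; apply/hasP; exists f'; rewrite ?xE.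
  by apply/le/(subsetP sub); rewrite xE set11.
have [k] := sp m pm; rewrite inE => /hasP[f fi /eqP fE] mk.
exists (compl_monomial f); first exact: map_f.
by apply/compl_monomial_le_add => j; rewrite fE => /set1P ->.
Qed.

Theorem theorem2p2 (n : nat) (hn : (4 <= n)%N) (K : fieldType) (G : rel 'I_n)
    (G_sym : ssrbool.symmetric G) (G_irr : irreflexive G)
    (G_no_isolated : forall i : 'I_n, exists j : 'I_n, G i j) :
  [<-> has_linear_quotients (compl_edge_ideal K G);
       has_linear_resolution (compl_edge_ideal K G);
       linearly_related (compl_edge_ideal K G);
       forall i j : 'I_n, connect G i j].
Proof.
tfae.
- exact: linear_quotients_linear_resolution.
- exact: linear_resolution_related.
- by apply: linearly_related_connected => //; apply: leq_trans hn.
exact: connected_linear_quotients.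
Qed.
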